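(* Let $\mathcal{G}$ be an RCOP coloring of the complete graph on $[n]$. Then $\mathcal{L}_{\mathcal{G}}^{-1}$ is a Jordan algebra; that is, $\mathcal{L}_{\mathcal{G}}^{-1}$ is a subalgebra of the Jordan algebra on the space $\mathbb{S}^n$ of real symmetric $n\times n$ matrices.
   Context: A colored graph $\mathcal{G}$ is a finite simple undirected graph on vertex set $[n]$ with a coloring $\lambda$ of its vertices and edges; $\Gamma(\mathcal{G})$ is the group of graph automorphisms preserving all vertex and edge colors. $\mathcal{G}$ is RCOP if (1) the vertex colors and edge colors form disjoint sets, (2) any two same-colored vertices are mapped to one another by some element of $\Gamma(\mathcal{G})$, and (3) any two same-colored edges are mapped to one another by some element of $\Gamma(\mathcal{G})$. $\mathcal{L}_{\mathcal{G}}$ is the linear space of real symmetric $n\times n$ matrices $K=(k_{ij})$ with $k_{ij}=0$ whenever $i\neq j$ and $\{i,j\}$ is not an edge, $k_{ii}=k_{jj}$ whenever $\lambda(i)=\lambda(j)$, and $k_{ij}=k_{uv}$ whenever edges $\{i,j\},\{u,v\}$ have the same color. $\mathcal{L}_{\mathcal{G}}^{-1}$ is the Zariski closure of $\{\Sigma:\Sigma^{-1}\in\mathcal{L}_{\mathcal{G}}\}$. The Jordan algebra on $\mathbb{S}^n$ is $\mathbb{S}^n$ with product $X\bullet Y=\tfrac12(XY+YX)$; a subalgebra is a linear subspace closed under $\bullet$. *)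

(* Defs.v *)
From mathcomp Require Import all_boot all_order all_algebra all_fingroup.
From mathcomp Require Import classical_sets reals.
From mathcomp Require mpoly.

Set Implicit Arguments.
Unset Strict Implicit.
Unset Printing Implicit Defensive.

Import GRing.Theory.
Local Open Scope classical_set_scope.
Local Open Scope ring_scope.

(* The color of the edge {i, j} is [ecolor [set i; j]]; the value of [ecolor]
   at a set that is not an edge is irrelevant. *)
Record colored_graph (n : nat) (C : eqType) := ColoredGraph {
  adj : rel 'I_n;
  adj_sym : symmetric adj;
  adj_irr : irreflexive adj;
  vcolor : 'I_n -> C;
  ecolor : {set 'I_n} -> C
}.

Section ColoredGraph.
Variables (n : nat) (C : eqType) (G : colored_graph n C).

Definition complete_graph : Prop := forall i j : 'I_n, i != j -> adj G i j.

Definition color_aut : {set {perm 'I_n}} :=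
  [set s : {perm 'I_n} |
    [forall i, vcolor G (s i) == vcolor G i] &&
    [forall i, forall j,
       (adj G (s i) (s j) == adj G i j) &&
       (adj G i j ==>
          (ecolor G [set s i; s j]%SET == ecolor G [set i; j]%SET))]]%SET.

Lemma color_autP (s : {perm 'I_n}) :
  reflect [/\ forall i, vcolor G (s i) = vcolor G i,
              forall i j, adj G (s i) (s j) = adj G i j
            & forall i j, adj G i j ->
                ecolor G [set s i; s j]%SET = ecolor G [set i; j]%SET]
          (s \in color_aut).
Proof.
rewrite inE; apply: (iffP andP) => [[/forallP Hv /forallP He]|[Hv Ha He]].
  split=> [i|i j|i j aij]; first exact/eqP.
    by have /forallP/(_ j)/andP[/eqP] := He i.
  by have /forallP/(_ j)/andP[_] := He i; rewrite aij => /eqP.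
split; apply/forallP => i; first exact/eqP.
apply/forallP => j; rewrite Ha eqxx /=.
by apply/implyP => /He ->.
Qed.

Lemma color_aut_group_set : group_set color_aut.
Proof.
apply/group_setP; split.
  by apply/color_autP; split=> *; rewrite !perm1.
move=> s t /color_autP[sv sa se] /color_autP[tv ta te].
apply/color_autP; split=> [i|i j|i j aij]; rewrite !permM ?tv ?ta //.
by rewrite te ?sa // se.
Qed.

Canonical color_aut_group := Group color_aut_group_set.

Definition RCOP : Prop :=
  [/\ forall i u v, adj G u v -> vcolor G i != ecolor G [set u; v]%SET,
      forall i j, vcolor G i = vcolor G j ->
        exists2 s : {perm 'I_n}, s \in color_aut & s i = j
    & forall i j u v, adj G i j -> adj G u v ->
        ecolor G [set i; j]%SET = ecolor G [set u; v]%SET ->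
        exists2 s : {perm 'I_n}, s \in color_aut &
          (s @: [set i; j] = [set u; v])%SET].

End ColoredGraph.

Definition sym_mx (R : realType) (n : nat) : set 'M[R]_n :=
  [set K | K^T = K].

Definition colored_space (R : realType) (n : nat) (C : eqType)
    (G : colored_graph n C) : set 'M[R]_n :=
  [set K | [/\ sym_mx K,
      forall i j, i != j -> ~~ adj G i j -> K i j = 0,
      forall i j, vcolor G i = vcolor G j -> K i i = K j j
    & forall i j u v, adj G i j -> adj G u v ->
        ecolor G [set i; j]%SET = ecolor G [set u; v]%SET ->
        K i j = K u v]].

(* Closure in the affine space of all n x n matrices, with one polynomial
   variable per entry (ordered as in [mxvec]).  For subsets of [sym_mx] this is
   the closure in the space of symmetric matrices, which is itself closed. *)
Definition zariski_closure (R : realType) (n : nat) (S : set 'M[R]_n) :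
    set 'M[R]_n :=
  [set X | forall p : mpoly.mpoly (n * n) R,
     (forall Y, S Y -> mpoly.meval (fun k => mxvec Y 0 k) p = 0) ->
     mpoly.meval (fun k => mxvec X 0 k) p = 0].

(* [invmx] is the identity on singular matrices, hence the explicit
   invertibility condition. *)
Definition inverse_variety (R : realType) (n : nat) (C : eqType)
    (G : colored_graph n C) : set 'M[R]_n :=
  zariski_closure
    [set Sigma | Sigma \in unitmx /\ colored_space G (invmx Sigma)].

Definition jordan_prod (R : realType) (n : nat) (X Y : 'M[R]_n) : 'M[R]_n :=
  2^-1 *: (X *m Y + Y *m X).

Definition jordan_subalgebra (R : realType) (n : nat) (A : set 'M[R]_n) : Prop :=
  [/\ A `<=` @sym_mx R n,
      submod_closed [in A]
    & forall X Y, A X -> A Y -> A (jordan_prod X Y)].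

(* Main.v *)
Require Import Defs.
From mathcomp Require Import all_boot all_order all_algebra all_fingroup.
From mathcomp Require Import classical_sets reals.
From mathcomp Require Import -(notations) mpoly.

(** For an RCOP coloring of the complete graph, [colored_space G] is exactly the
    space of symmetric matrices commuting with the permutation matrices of the
    color-preserving automorphisms.  This space is linear, closed under the
    Jordan product, and stable under inversion of its invertible elements.  The
    last property, together with the density of the invertible matrices along
    the line [X - t I], shows that the inverse variety is the space itself. *)

Set Implicit Arguments.
Unset Strict Implicit.
Unset Printing Implicit Defensive.

Import GRing.Theory Num.Theory.
Local Open Scope ring_scope.

Lemma comm_perm_mxP (R : pzRingType) (n : nat) (s : {perm 'I_n}) (A : 'M[R]_n) :
  comm_mx (perm_mx s) A <-> forall i j, A (s i) (s j) = A i j.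
Proof.
(* Left multiplication by [perm_mx s] permutes rows by [s], right multiplication permutes columns by
   [s^-1]; taking column [s j] cancels the inverse. *)
rewrite /comm_mx -row_permE -{2}[s]invgK -col_permE.
split=> [/matrixP sA i j|sA]; first by have := sA i (s j); rewrite !mxE permK.
by apply/matrixP=> i j; rewrite !mxE -[in LHS](permKV s j) sA.
Qed.

Lemma comm_mxZ (R : comPzRingType) (n : nat) (a : R) (A B : 'M[R]_n) :
  comm_mx A B -> comm_mx A (a *: B).
Proof. by rewrite /comm_mx -scalemxAr -scalemxAl => ->. Qed.

Lemma comm_invmx (R : comUnitRingType) (n : nat) (A B : 'M[R]_n) :
  B \in unitmx -> comm_mx A B -> comm_mx A (invmx B).
Proof.
move=> uB AB; rewrite /comm_mx -[LHS](mulKmx uB) (mulmxA B) -AB.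
by rewrite -mulmxA mulmxV // mulmx1.
Qed.

Lemma unitmx_sub_scalar (F : fieldType) (n : nat) (A : 'M[F]_n) (t : F) :
  ~~ root (char_poly A) t -> A - t%:M \in unitmx.
Proof.
by rewrite -eigenvalue_root_char negbK kermx_eq0 row_free_unit.
Qed.

Lemma poly_eq0_horner (F : numFieldType) (p : {poly F}) :
  (forall t, p.[t] = 0) -> p = 0.
Proof.
(* In characteristic 0 the numbers 0, ..., [size p - 1] are distinct, which is one root more than
   the degree allows. *)
move=> p0; apply: (@roots_geq_poly_eq0 _ p (mkseq (fun k => k%:R) (size p))).
- by apply/allP=> t _; rewrite /root p0.
- by rewrite mkseq_uniq //; apply: mulrIn; rewrite oner_eq0.
- by rewrite size_mkseq.
Qed.

Lemma horner_mmapC (n : nat) (R : comNzRingType) (h : 'I_n -> {poly R})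
    (p : mpoly n R) (t : R) :
  (mmap (@polyC R) h p).[t] = meval (fun k => (h k).[t]) p.
Proof.
rewrite mevalE /mmap horner_sum; apply: eq_bigr => m _.
rewrite hornerM hornerC /mmap1 horner_prod.
by congr (_ * _); apply: eq_bigr => i _; rewrite horner_exp.
Qed.

(** The difference of two entries is a linear polynomial, so its vanishing passes to the closure.
    Both symmetry and commutation with a permutation matrix have this form. *)
Lemma zariski_closure_entry_eq (R : realType) (n : nat) (S : set 'M[R]_n)
    (i j k l : 'I_n) :
  (forall Y, S Y -> Y i j = Y k l) ->
  forall X, zariski_closure S X -> X i j = X k l.
Proof.
move=> SE X clX.
pose U a b : mpoly (n * n) R := mpolyX R (mnm1 (mxvec_index a b)).
apply/eqP; rewrite -subr_eq0; apply/eqP.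
have evU Z : meval (fun a => mxvec Z 0 a) (U i j - U k l) = Z i j - Z k l.
  by rewrite mevalB !mevalXU !mxvecE.
by rewrite -evU; apply: clX => Y /SE eqY; rewrite evU eqY subrr.
Qed.

(** A polynomial vanishing on [S] restricts to a univariate [q] on the line [X - t I]. Off the
    finitely many eigenvalues of [X], [q] vanishes; hence [q] is zero, in particular at [t = 0]. *)
Lemma zariski_closure_shift (R : realType) (n : nat) (S : set 'M[R]_n)
    (X : 'M[R]_n) :
  (forall t, X - t%:M \in unitmx -> S (X - t%:M)) -> zariski_closure S X.
Proof.
move=> SX p p0.
pose h k := (mxvec X 0 k)%:P - 'X * (mxvec (1%:M : 'M[R]_n) 0 k)%:P.
have hE k t : (h k).[t] = mxvec (X - t%:M) 0 k.
  by rewrite !hornerE -(scalemx1 n t) linearB linearZ !mxE.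
pose q := mmap (@polyC R) h p.
have qE t : q.[t] = meval (fun k => mxvec (X - t%:M) 0 k) p.
  by rewrite horner_mmapC; apply: meval_eq => k; rewrite hE.
suff q0 : q = 0 by have := qE 0; rewrite q0 horner0 raddf0 subr0.
(* The factor [char_poly X] covers the eigenvalues, where nothing is known about [q]. *)
have : q * char_poly X = 0.
  apply: poly_eq0_horner => t; rewrite hornerM.
  have [/rootP->|nrt] := boolP (root (char_poly X) t); first by rewrite mulr0.
  by rewrite qE p0 ?mul0r //; apply/SX/unitmx_sub_scalar.
move/eqP; rewrite mulf_eq0 => /orP[/eqP//|].
by rewrite (negPf (monic_neq0 (char_poly_monic X))).
Qed.

Section CompleteRCOP.
Variables (R : realType) (n : nat) (C : eqType) (G : colored_graph n C).
Hypotheses (Gcomplete : complete_graph G) (Grcop : RCOP G).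

(** Automorphisms preserve colors, and completeness makes every off-diagonal entry an edge entry, so
    [K] is invariant. Conversely, RCOP makes each color class a single orbit, on which an invariant
    [K] is constant. *)
Lemma colored_spaceP (K : 'M[R]_n) :
  colored_space G K <->
  sym_mx K /\ forall s, s \in color_aut G -> comm_mx (perm_mx s) K.
Proof.
case: Grcop => _ vtr etr; split=> [[symK _ vK eK]|[symK sK]].
  split=> // s /color_autP[sv sa se]; apply/comm_perm_mxP => i j.
  have [->|/Gcomplete aij] := eqVneq i j; first exact/vK/sv.
  by apply: eK; rewrite ?sa ?se.
split=> // [i j /Gcomplete->//|i j|i j u v aij auv].
  by case/vtr=> s /sK/comm_perm_mxP sKE <-; rewrite sKE.
case/etr=> // s /sK/comm_perm_mxP sKE; rewrite imsetU1 imset_set1 => /setP suv.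
rewrite -sKE; have := suv (s i); have := suv (s j).
have nsij : s i != s j.
  by rewrite (inj_eq perm_inj); apply: contraTneq aij => ->; rewrite adj_irr.
rewrite !inE !eqxx orbT /= => /esym sj /esym si.
(* As only the unordered edge is mapped, [s] may send [i, j] to [v, u]; symmetry of [K] settles that
   case. *)
case/orP: si sj nsij => /eqP-> /orP[]/eqP->; rewrite ?eqxx // => _.
by rewrite -{1}symK mxE.
Qed.

Lemma colored_space_inv (K : 'M[R]_n) :
  K \in unitmx -> colored_space G K -> colored_space G (invmx K).
Proof.
move=> uK /colored_spaceP[symK sK]; apply/colored_spaceP; split.
  by rewrite /sym_mx /= trmx_inv symK.
by move=> s /sK; exact: comm_invmx.
Qed.

Lemma colored_space_linear (a : R) (K L : 'M[R]_n) :
  colored_space G K -> colored_space G L -> colored_space G (a *: K + L).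
Proof.
move=> /colored_spaceP[symK sK] /colored_spaceP[symL sL].
apply/colored_spaceP; split; first by rewrite /sym_mx /= linearP /= symK symL.
by move=> s sG; apply/comm_mxD/sL => //; apply/comm_mxZ/sK.
Qed.

Lemma colored_space_scalar (a : R) : colored_space G (a%:M : 'M[R]_n).
Proof.
apply/colored_spaceP; split; first by rewrite /sym_mx /= tr_scalar_mx.
by move=> s _; apply: comm_mx_scalar.
Qed.

(** A commutant is closed under products and sums, and transposition merely swaps [K L] and
    [L K]. *)
Lemma colored_space_jordan_prod (K L : 'M[R]_n) :
  colored_space G K -> colored_space G L -> colored_space G (jordan_prod K L).
Proof.
move=> /colored_spaceP[symK sK] /colored_spaceP[symL sL].
apply/colored_spaceP; split.
  by rewrite /sym_mx /= linearZ linearD /= !trmx_mul symK symL addrC.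
move=> s sG; apply: comm_mxZ.
by apply: comm_mxD; apply: comm_mxM; by [apply: sK | apply: sL].
Qed.

Lemma inverse_varietyE (X : 'M[R]_n) :
  inverse_variety G X <-> colored_space G X.
Proof.
split=> [clX|GX].
  (* Stability under inversion puts the set being closed inside the space; the equations of the
     space then extend to the closure. *)
  have GS (Y : 'M[R]_n) :
      Y \in unitmx /\ colored_space G (invmx Y) -> colored_space G Y.
    by case=> uY /colored_space_inv; rewrite unitmx_inv invmxK; apply.
  apply/colored_spaceP; split.
    apply/matrixP=> i j; rewrite mxE; apply: zariski_closure_entry_eq clX.
    by move=> Y /GS/colored_spaceP[symY _]; rewrite -[in LHS]symY mxE.
  move=> s sG; apply/comm_perm_mxP => i j.
  apply: zariski_closure_entry_eq clX => Y /GS/colored_spaceP[_ sY].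
  by move: i j; apply/comm_perm_mxP/sY.
(* The space contains the scalar matrices, so the whole line [X - t I] stays in it. *)
apply: zariski_closure_shift => t ut; split=> //.
apply: colored_space_inv => //; rewrite addrC -scaleN1r.
by apply: colored_space_linear => //; apply: colored_space_scalar.
Qed.

End CompleteRCOP.

Theorem theorem5p5 (R : realType) (n : nat) (C : eqType)
    (G : colored_graph n C) (Gcomplete : complete_graph G) (Grcop : RCOP G) :
  jordan_subalgebra (@inverse_variety R n C G).
Proof.
have GE := @inverse_varietyE R n C G Gcomplete Grcop.
split=> [X /GE[]//||X Y /GE GX /GE GY]; last first.
  exact/GE/colored_space_jordan_prod.
split=> [|a X Y]; rewrite !in_setE.
  by apply/GE; rewrite -[0](raddf0 (@scalar_mx R n)); exact: colored_space_scalar.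
by move=> /GE GX /GE GY; apply/GE/colored_space_linear.
Qed.
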